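(* For $i,j,n\ge 0$ let $q(i,j,n)$ be the number of walks with $n$ steps, each in $\{(1,0),(-1,0),(0,1),(0,-1)\}$, that start at $(0,0)$, end at $(i,j)$, and stay in the quarter plane $\mathbb{Z}_+^2=\{0,1,2,\dots\}^2$. Then, as $n\to\infty$, $$\sum_{i,j\ge 0}q(i,j,n)\sim\frac{4}{\pi}\,\frac{4^{n}}{n} .$$
   Context: Here $f(n)\sim g(n)$ means $f(n)/g(n)\to 1$ as $n\to\infty$. *)

(* Defs.v *)
From mathcomp Require Import all_boot all_order all_algebra.
From mathcomp Require Import all_classical all_reals all_analysis.
Import Order.TTheory GRing.Theory Num.Theory.

Set Implicit Arguments.
Unset Strict Implicit.
Unset Printing Implicit Defensive.

Local Open Scope ring_scope.

Definition unit_steps : seq (int * int) :=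
  [:: (1, 0); (-1, 0); (0, 1); (0, -1)].

Definition step := seq_sub unit_steps.

(* Position after the first k steps; the pairs are added componentwise. *)
Definition position (w : seq step) (k : nat) : int * int :=
  \sum_(s <- take k w) val s.

Definition in_quarter_plane (p : int * int) : bool :=
  (0 <= p.1) && (0 <= p.2).

Definition quarter_plane_walk (n : nat) (w : n.-tuple step) : bool :=
  [forall k : 'I_n.+1, in_quarter_plane (position w k)].

Definition q (i j n : nat) : nat :=
  #|[set w : n.-tuple step |
      quarter_plane_walk w && (position w n == (i%:Z, j%:Z))]|.

(* A sum over an infinite index set, as in \sum_(p \in [set: nat * nat]), is 0
   by convention when infinitely many terms are nonzero; by this lemma the
   convention plays no role for the endpoints of walks of a given length. *)
Lemma q_finite_support (R : realType) (n : nat) :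
  finite_set [set p : nat * nat | (q p.1 p.2 n)%:R != 0 :> R]%classic.
Proof.
apply: (@sub_finite_set _ _ [set` [seq (`|(position w n).1|%N,
  `|(position w n).2|%N) | w : n.-tuple step]]%classic); last first.
  exact: finite_seq.
move=> [i j] /=; rewrite pnatr_eq0 -lt0n => /card_gt0P[w].
rewrite inE => /andP[_ /eqP wij].
by apply/fintype.imageP; exists w; rewrite ?inE // wij.
Qed.

(* Main.v *)
(* Let h_n(p) be the number of n-step walks from p staying in the quadrant and
   T the sum over the four neighbours.  By the reflection principle h_n = T^n f
   for f(x,y) = s(x) s(y), where s = 1 on x >= 0, s(-1) = 0 and s = -1 below,
   since T keeps f odd about the lines x = -1 and y = -1.  At the origin s may be
   replaced by the indicator of {0, 1}, the difference being odd about 0.  In the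
   coordinates x + y and x - y the operator T is a product of two one-dimensional
   ones, which gives
     h_n(0,0) = 'C(n, n./2) * 'C(n+1, (n+1)./2).
   Wallis' product then yields n pi 'C(n, n./2)^2 <= 2 * 4^n <=
   (n+2) pi 'C(n, n./2)^2, and hence the ratio lies between 1 - 3/n and 1. *)

Require Import Defs.
From mathcomp Require Import all_boot all_order all_algebra.
From mathcomp Require Import all_classical all_reals all_analysis.
From mathcomp Require Import ring lra zify.
Import Order.TTheory GRing.Theory Num.Theory.
Import numFieldNormedType.Exports.

Local Open Scope ring_scope.

(** * Counting walks by their first step *)

Definition neighbour_sum (f : int * int -> int) (p : int * int) : int :=
  \sum_(s <- unit_steps) f (p + s).

Lemma neighbour_sumE f x y : neighbour_sum f (x, y) =
  f (x + 1, y) + f (x - 1, y) + f (x, y + 1) + f (x, y - 1).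
Proof.
rewrite /neighbour_sum /unit_steps !big_cons big_nil /= addr0 !addrA.
by rewrite -![(x, y) + _]/(_, _) /= !addr0.
Qed.

(** The starting point moves along with the recursion, so that walks from any point can be treated
    by induction. *)
Fixpoint stays_in (p : int * int) (w : seq step) : bool :=
  in_quarter_plane p &&
  (if w is s :: w' then stays_in (p + val s) w' else true).

Lemma stays_inP p (w : seq step) : reflect
  (forall k, (k <= size w)%N -> in_quarter_plane (p + position w k))
  (stays_in p w).
Proof.
elim: w p => [|s w IHw] p /=.
  rewrite andbT; apply: (iffP idP) => [pQ k _|/(_ 0%N isT)];
    by rewrite /position /= big_nil addr0.
apply: (iffP andP) => [[pQ /IHw wQ] [|k] kw|wQ].
- by rewrite /position take0 big_nil addr0.
- by rewrite /position /= big_cons addrA; apply: wQ.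
- split; first by have := wQ 0%N isT; rewrite /position take0 big_nil addr0.
  apply/IHw => k kw; have := wQ k.+1 kw.
  by rewrite /position /= big_cons addrA.
Qed.

Lemma quarter_plane_walkE n (w : n.-tuple step) :
  quarter_plane_walk w = stays_in 0 w.
Proof.
apply/forallP/stays_inP => [wQ k|wQ k].
  by rewrite size_tuple -ltnS add0r => kn; exact: (wQ (Ordinal kn)).
by rewrite -[position _ _]add0r; apply: wQ; rewrite size_tuple -ltnS.
Qed.

Definition walks_from (n : nat) (p : int * int) : nat :=
  #|[set w : n.-tuple step | stays_in p w]|.

Lemma sum_step (F : int * int -> int) :
  \sum_(s : step) F (val s) = \sum_(s <- unit_steps) F s.
Proof.
rewrite -[in RHS](@val_seq_sub_enum _ unit_steps) // big_map.
apply: perm_big; apply: uniq_perm; rewrite ?index_enum_uniq ?undup_uniq //.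
by move=> s; rewrite mem_index_enum mem_seq_sub_enum.
Qed.

Lemma walks_from0 p : walks_from 0 p = in_quarter_plane p.
Proof.
rewrite /walks_from; case: (boolP (in_quarter_plane p)) => pQ.
  rewrite (_ : [set _ | _] = [set [tuple]]) ?cards1 //.
  by apply/setP => w; rewrite !inE tuple0 /= pQ eqxx.
by apply: eq_card0 => w; rewrite inE tuple0 /= (negbTE pQ).
Qed.

(** Cutting off the first step is a bijection from tuples of length [n.+1] to pairs. Integer values
    make room for the signs of the reflection principle. *)
Lemma walks_fromS n p : (walks_from n.+1 p)%:Z =
  (in_quarter_plane p)%:R * neighbour_sum (fun r => (walks_from n r)%:Z) p.
Proof.
have cardE m r : (walks_from m r)%:Z =
    \sum_(w : m.-tuple step) (stays_in r w)%:R.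
  rewrite /walks_from -sum1dep_card big_mkcond /= -natr_sum.
  by rewrite natz; congr Posz; apply: eq_bigr => w _; case: stays_in.
rewrite cardE /neighbour_sum.
under [in RHS]eq_bigr do rewrite cardE.
rewrite -(sum_step (fun s => \sum_(w : n.-tuple step) (stays_in (p + s) w)%:R)).
rewrite mulr_sumr; under [in RHS]eq_bigr do rewrite mulr_sumr.
rewrite pair_big /=.
rewrite (reindex (fun sw : step * n.-tuple step => [tuple of sw.1 :: sw.2])) /=.
  by apply: eq_bigr => -[s w] _ /=; rewrite -natrM mulnb.
exists (fun w : n.+1.-tuple step => (thead w, [tuple of behead w])).
  by move=> [s w] _ /=; congr pair; apply/val_inj.
by move=> w _ /=; rewrite [RHS]tuple_eta.
Qed.

(** * Reflection principle *)

(* Odd about [x = -1], where it vanishes. *)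
Definition odd_sign (x : int) : int := (0 <= x)%R%:R - (x <= -2)%R%:R.

Definition ind01 (x : int) : int := ((x == 0) || (x == 1))%R%:R.

Lemma neighbour_sum_ext f g : f =1 g -> neighbour_sum f =1 neighbour_sum g.
Proof. by move=> fg p; apply: eq_bigr. Qed.

Lemma iter_neighbour_sum_ext n f g :
  f =1 g -> iter n neighbour_sum f =1 iter n neighbour_sum g.
Proof. by move=> fg; elim: n => //= n; apply: neighbour_sum_ext. Qed.

Lemma iter_neighbour_sumD n f g p :
  iter n neighbour_sum (fun r => f r + g r) p =
  iter n neighbour_sum f p + iter n neighbour_sum g p.
Proof.
elim: n p => //= n IHn p; rewrite (neighbour_sum_ext _ _ IHn).
by rewrite /neighbour_sum big_split.
Qed.

(** The reflection of [x] to [a - x] swaps left and right neighbours, so oddness persists. The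
    centre is general because both [a = -2] and [a = 0] occur. *)
Lemma iter_neighbour_sum_oddl n (f : int * int -> int) (a x y : int) :
  (forall x y : int, f (a - x, y) = - f (x, y)) ->
  iter n neighbour_sum f (a - x, y) = - iter n neighbour_sum f (x, y).
Proof.
move=> f_odd; elim: n x y => //= n IHn x y; rewrite !neighbour_sumE.
have -> : a - x + 1 = a - (x - 1) by lia.
have -> : a - x - 1 = a - (x + 1) by lia.
by rewrite !IHn; ring.
Qed.

Lemma iter_neighbour_sum_oddr n (f : int * int -> int) (a x y : int) :
  (forall x y : int, f (x, a - y) = - f (x, y)) ->
  iter n neighbour_sum f (x, a - y) = - iter n neighbour_sum f (x, y).
Proof.
move=> f_odd; elim: n x y => //= n IHn x y; rewrite !neighbour_sumE.
have -> : a - y + 1 = a - (y - 1) by lia.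
have -> : a - y - 1 = a - (y + 1) by lia.
by rewrite !IHn; ring.
Qed.

Definition sign_prod (p : int * int) : int := odd_sign p.1 * odd_sign p.2.

(** The lines at -1 are included so that the induction closes: all neighbours of quadrant points lie
    in this range. *)
Lemma walks_fromE n (x y : int) : -1 <= x -> -1 <= y ->
  (walks_from n (x, y))%:Z = iter n neighbour_sum sign_prod (x, y).
Proof.
have odd_signN x' : odd_sign (-2 - x') = - odd_sign x'
  by rewrite /odd_sign !natz; lia.
elim: n x y => [|n IHn] x y x_ge y_ge.
  rewrite walks_from0 /in_quarter_plane /= /sign_prod /odd_sign /=.
  rewrite (_ : (x <= -2) = false) 1?(_ : (y <= -2) = false); lia.
rewrite walks_fromS /in_quarter_plane /=.
case: (boolP (0 <= x)) => /= x0; last first.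
  have {x_ge x0}-> : x = -1 by lia.
  (* The reflection fixes this point, so the value there equals its own opposite and vanishes. *)
  have := @iter_neighbour_sum_oddl n.+1 sign_prod (-2) (-1) y.
  rewrite (_ : -2 - -1 = -1) // mul0r /= => odd_l.
  suff /odd_l : forall a b, sign_prod (-2 - a, b) = - sign_prod (a, b) by lia.
  by move=> a b; rewrite /sign_prod /= odd_signN mulNr.
case: (boolP (0 <= y)) => /= y0; last first.
  have {y_ge y0}-> : y = -1 by lia.
  have := @iter_neighbour_sum_oddr n.+1 sign_prod (-2) x (-1).
  rewrite (_ : -2 - -1 = -1) // mul0r /= => odd_r.
  suff /odd_r : forall a b, sign_prod (a, -2 - b) = - sign_prod (a, b) by lia.
  by move=> a b; rewrite /sign_prod /= odd_signN mulrN.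
by rewrite mul1r !neighbour_sumE !IHn //; lia.
Qed.

(** * Diagonal coordinates and one-dimensional paths *)

Definition two_sum (f : int -> int) (z : int) : int := f (z + 1) + f (z - 1).

(** A unit step changes both [x + y] and [x - y] by 1 or -1, and the four steps realise each pair of
    signs once. *)
Lemma iter_neighbour_sum_diag n f g x y :
  iter n neighbour_sum (fun p => f (p.1 + p.2) * g (p.1 - p.2)) (x, y) =
  iter n two_sum f (x + y) * iter n two_sum g (x - y).
Proof.
elim: n x y => //= n IHn x y; rewrite neighbour_sumE !IHn /two_sum.
rewrite (_ : x + 1 + y = x + y + 1) 1?(_ : x - 1 + y = x + y - 1); try lia.
rewrite (_ : x + (y + 1) = x + y + 1) 1?(_ : x + (y - 1) = x + y - 1); try lia.
rewrite (_ : x + 1 - y = x - y + 1) 1?(_ : x - 1 - y = x - y - 1); try lia.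
rewrite (_ : x - (y + 1) = x - y - 1) 1?(_ : x - (y - 1) = x - y + 1); lia.
Qed.

(** Too far for [n] unit steps to reach [a]; this settles the border case [k = 0] of Pascal's rule
    below. *)
Lemma iter_two_sum_out n (a z : int) : z < a - n%:Z ->
  iter n two_sum (fun z => (z == a)%:R) z = 0.
Proof.
elim: n z => [|n IHn] z z_lt /=; first by rewrite natz; lia.
by rewrite /two_sum !IHn //; lia.
Qed.

(** Paths from this point to [a] have [k] steps down and [n - k] up; the induction is Pascal's
    rule. *)
Lemma iter_two_sum_bin n (a : int) (k : nat) :
  iter n two_sum (fun z => (z == a)%:R) (a + k%:Z * 2 - n%:Z) = 'C(n, k)%:Z.
Proof.
elim: n k => [|n IHn] [|k] /=; rewrite ?bin0 ?bin0n ?binS /two_sum ?natz;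
  try lia.
- rewrite (_ : _ + 1 = a + 0%N%:Z * 2 - n%:Z); last lia.
  by rewrite IHn bin0 iter_two_sum_out //; lia.
- rewrite (_ : _ + 1 = a + k.+1%:Z * 2 - n%:Z); last lia.
  by rewrite (_ : _ - 1 = a + k%:Z * 2 - n%:Z) ?IHn //; lia.
Qed.

Lemma iter_two_sum_parity n (a z : int) : odd (n + `|z - a|) ->
  iter n two_sum (fun z => (z == a)%:R) z = 0.
Proof.
elim: n z => [|n IHn] z /=; first by rewrite natz; lia.
by move=> nz; rewrite /two_sum !IHn //; lia.
Qed.

Lemma walks_from_origin n :
  walks_from n (0, 0) = ('C(n, n./2) * 'C(n.+1, n.+1./2))%N.
Proof.
pose D x := odd_sign x - ind01 x.
have D_odd x : D (0 - x) = - D x.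
  by rewrite /D /odd_sign /ind01 !natz; lia.
pose delta a : int -> int := fun z => (z == a)%:R.
(* The four points of {0,1}^2 split into (1,0), (0,1), with sum 1 and difference 1 or -1, and (0,0),
   (1,1), with sum 0 or 2 and difference 0. Each [two_sum] acts as one extra step in one diagonal
   coordinate. *)
have decomp p : sign_prod p =
    delta 1 (p.1 + p.2) * two_sum (delta 0) (p.1 - p.2)
    + two_sum (delta 1) (p.1 + p.2) * delta 0 (p.1 - p.2)
    + D p.1 * ind01 p.2 + odd_sign p.1 * D p.2.
  transitivity (ind01 p.1 * ind01 p.2 + D p.1 * ind01 p.2
    + odd_sign p.1 * D p.2).
    by rewrite /sign_prod /D; ring.
  congr (_ + _ + _); case: p => x y /=.
  rewrite /ind01 /delta /two_sum.
  case: (boolP (_ || _)) => hx; case: (boolP (_ || _)) => hy;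
    case: (boolP (x + y == 1)) => hu; case: (boolP (x - y == 0)) => hv;
    rewrite !natz; lia.
apply/eqP; rewrite -eqz_nat walks_fromE //.
rewrite (iter_neighbour_sum_ext _ _ _ decomp) 2!iter_neighbour_sumD.
(* The origin is fixed by the reflections about 0, so the two odd remainders contribute nothing. *)
have eq0_opp (v : int) : v = - v -> v = 0 by lia.
rewrite (eq0_opp (iter n neighbour_sum (fun r => D r.1 * ind01 r.2) (0, 0)));
  last first.
  by apply: (iter_neighbour_sum_oddl n _ 0 0 0) => x y /=; rewrite D_odd mulNr.
rewrite (eq0_opp (iter n neighbour_sum (fun r => odd_sign r.1 * D r.2) (0, 0)));
  last first.
  by apply: (iter_neighbour_sum_oddr n _ 0 0 0) => x y /=; rewrite D_odd mulrN.
rewrite 2!addr0 iter_neighbour_sumD.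
have diag0 f g :
    iter n neighbour_sum (fun p => f (p.1 + p.2) * g (p.1 - p.2)) (0, 0) =
    iter n two_sum f 0 * iter n two_sum g 0.
  exact: (iter_neighbour_sum_diag n f g 0 0).
rewrite (diag0 (delta 1) (two_sum (delta 0))).
rewrite (diag0 (two_sum (delta 1)) (delta 0)).
rewrite -!iterSr PoszM.
have at_zero m a (k : nat) : a + k%:Z * 2 - m%:Z = 0 ->
    iter m two_sum (delta a) 0 = 'C(m, k)%:Z.
  by move=> <-; exact: iter_two_sum_bin.
have parity0 m (a : int) : odd (m + `|a|) -> iter m two_sum (delta a) 0 = 0.
  by move=> ma; apply: iter_two_sum_parity; lia.
(* By parity only one of the two products survives; which one depends on [n], the resulting formula
   does not. *)
case: (boolP (odd n)) => n_odd.
  rewrite (parity0 n 0) ?mulr0 ?addr0; last by lia.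
  by rewrite (at_zero n 1 n./2) 1?(at_zero n.+1 0 n.+1./2) //; lia.
rewrite (parity0 n 1) ?mul0r ?add0r; last by lia.
by rewrite (at_zero n 0 n./2) 1?(at_zero n.+1 1 n.+1./2) 1?mulrC //; lia.
Qed.

(** * Wallis integrals *)

(* The recursion comes from integrating [sin ^+ m.+2] by parts. *)
Fixpoint sin_primitive (R : realType) (n : nat) : R -> R :=
  match n with
  | 0 => id
  | 1 => - cos
  | m.+2 => m.+2%:R^-1 *: (m.+1%:R *: sin_primitive R m - sin ^+ m.+1 * cos)
  end.

Lemma is_derive_sin_primitive (R : realType) n (x : R) :
  is_derive x 1 (sin_primitive R n) (sin x ^+ n).
Proof.
elim/ltn_ind: n => -[|[|n]] IHn /=.
- exact: is_derive_id.
- by rewrite expr1; apply: is_derive_eq; rewrite opprK.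
- have IH := IHn n (ltnW (leqnn _)).
  apply: is_derive_eq; rewrite /= /GRing.scale /=.
  have c2 := cos2sin2 x; rewrite [X in X * - _](_ : _ = sin x ^+ n.+1) ?fctE //.
  rewrite !exprS -natr1 -[n.+1%:R]natr1.
  have n_ge0 := ler0n R n.
  apply: (canLR (mulKf _)); first lra.
  transitivity (sin x ^+ n * ((n%:R + 1) * (1 - cos x ^+ 2) + sin x ^+ 2)).
    by ring.
  by rewrite c2; ring.
Qed.

(* The integral of [sin ^+ n] over [0, pi / 2]. *)
Definition wallis (R : realType) (n : nat) : R :=
  sin_primitive R n (pi / 2) - sin_primitive R n 0.

Lemma wallis0 (R : realType) : wallis R 0 = pi / 2.
Proof. by rewrite /wallis /= subr0. Qed.

Lemma wallis1 (R : realType) : wallis R 1 = 1.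
Proof. by rewrite /wallis /= !fctE cos0 cos_pihalf oppr0 opprK add0r. Qed.

Lemma wallisSS (R : realType) n :
  n.+2%:R * wallis R n.+2 = n.+1%:R * wallis R n.
Proof.
rewrite /wallis /= !fctE cos_pihalf sin0 /GRing.scale /= expr0n.
by rewrite mulr0 mul0r !subr0 -mulrBr -mulrBr mulVKf.
Qed.

(** On [0, pi / 2] the sine lies between 0 and 1, so the difference of the two primitives has
    nonnegative derivative. *)
Lemma wallis_le (R : realType) n : wallis R n.+1 <= wallis R n.
Proof.
rewrite /wallis -subr_ge0.
pose f : R -> R := sin_primitive R n - sin_primitive R n.+1.
have f_der (x : R) : is_derive x 1 f (sin x ^+ n - sin x ^+ n.+1).
  by apply: is_deriveB; exact: is_derive_sin_primitive.
have f_derivable (x : R) : derivable f x 1 by case: (f_der x).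
have pihalf_ge0 : 0 <= pi / 2 :> R by rewrite divr_ge0 ?pi_ge0.
have /(_ 0 (pi / 2)) f_le : {in `[0, pi / 2] &, {homo f : x y / x <= y}}.
  apply: ger0_derive1_le_cc => [//|x|]; last first.
    by apply: derivable_within_continuous.
  rewrite in_itv /= => /andP[x_ge x_le]; rewrite derive1E derive_val.
  rewrite exprS -{1}[_ ^+ n]mul1r -mulrBl mulr_ge0 //.
  rewrite exprn_ge0 // sin_ge0_pi // (ltW x_ge) /= (le_trans (ltW x_le)) //.
  by rewrite ler_pdivrMr // ler_peMr ?pi_ge0 // ler1n.
suff : sin_primitive R n 0 - sin_primitive R n.+1 0 <=
  sin_primitive R n (pi / 2) - sin_primitive R n.+1 (pi / 2) by lra.
by apply: f_le => //; rewrite in_itv /= ?lexx pihalf_ge0.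
Qed.

(** [wallisSS] makes the left side independent of [n]; its value is read off at [n = 0]. *)
Lemma wallis_prod (R : realType) n :
  n.+1%:R * (wallis R n * wallis R n.+1) = pi / 2.
Proof.
elim: n => [|n IHn]; first by rewrite wallis0 wallis1 mulr1 mul1r.
by rewrite mulrCA wallisSS mulrCA mulrC -mulrA mulrC -IHn; ring.
Qed.

(** * Bounds for middle binomial coefficients *)

Lemma central_binS m : (m.+1 * 'C(m.+1.*2, m.+1) = 2 * m.*2.+1 * 'C(m.*2, m))%N.
Proof.
rewrite doubleS -mul_bin_diag /=.
by have := mul_bin_down m.*2.+1 m; rewrite /=; nia.
Qed.

Lemma wallis_even (R : realType) m :
  wallis R m.*2 * 4 ^+ m = pi / 2 * 'C(m.*2, m)%:R.
Proof.
elim: m => [|m IHm]; first by rewrite wallis0 bin0 !mulr1.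
have m1_neq0 : m.+1%:R != 0 :> R by rewrite pnatr_eq0.
have rec := wallisSS R m.*2; rewrite -doubleS in rec.
have binS : m.+1%:R * 'C(m.+1.*2, m.+1)%:R =
    2 * m.*2.+1%:R * 'C(m.*2, m)%:R :> R.
  by rewrite -!natrM central_binS.
apply: (mulfI m1_neq0); rewrite exprS.
transitivity (2 * (m.+1.*2%:R * wallis R m.+1.*2) * 4 ^+ m).
  by rewrite -mul2n natrM; ring.
rewrite rec; transitivity (2 * m.*2.+1%:R * (wallis R m.*2 * 4 ^+ m)).
  by ring.
rewrite IHm; transitivity (pi / 2 * (m.+1%:R * 'C(m.+1.*2, m.+1)%:R) : R).
  by rewrite binS; ring.
by ring.
Qed.

(** With W for [wallis], monotonicity gives 2m W(2m)^2 <= pi/2 <= (2m+1) W(2m)^2, by comparison with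
    W(2m-1) W(2m) and W(2m) W(2m+1); [wallis_even] turns W(2m) into the binomial. *)
Lemma central_bin_bounds (R : realType) m :
  (m.*2%:R * (pi * 'C(m.*2, m)%:R ^+ 2) : R) <= 2 * 4 ^+ m.*2 /\
  (2 * 4 ^+ m.*2 : R) <= m.*2.+1%:R * (pi * 'C(m.*2, m)%:R ^+ 2).
Proof.
have pi0 : 0 < pi :> R := pi_gt0 R.
have p0 : 0 < 4 ^+ m :> R by rewrite exprn_gt0.
have c0 : 0 < 'C(m.*2, m)%:R :> R.
  by rewrite ltr0n bin_gt0 -addnn leq_addr.
have Wm := wallis_even R m.
have W0 : 0 < wallis R m.*2.
  by rewrite -(pmulr_lgt0 _ p0) Wm !mulr_gt0 // invr_gt0.
have W2 : 4 * wallis R m.*2 ^+ 2 * 4 ^+ m.*2 = pi ^+ 2 * 'C(m.*2, m)%:R ^+ 2.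
  rewrite -addnn exprD.
  transitivity (4 * (wallis R m.*2 * 4 ^+ m) ^+ 2).
    by rewrite addnn; ring.
  by rewrite Wm addnn; field.
have P0 : 0 < 4 ^+ m.*2 :> R by rewrite exprn_gt0.
have WE (k : R) : pi * (k * (pi * 'C(m.*2, m)%:R ^+ 2)) =
    4 * 4 ^+ m.*2 * (k * wallis R m.*2 ^+ 2).
  transitivity (k * (pi ^+ 2 * 'C(m.*2, m)%:R ^+ 2)); first by ring.
  by rewrite -W2; ring.
have piE : pi * (2 * 4 ^+ m.*2) = 4 * 4 ^+ m.*2 * (pi / 2) :> R by field.
split; rewrite -(ler_pM2l pi0) piE WE ler_pM2l ?mulr_gt0 //.
  (* The index 2m - 1 asks for m > 0; at m = 0 the left side is 0. *)
  case: m {Wm p0 c0 P0 W2 WE piE} W0 => [|m] W0.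
    by rewrite mul0r divr_ge0 ?ltW.
  rewrite doubleS in W0 *; rewrite -(wallis_prod R m.*2.+1) ler_wpM2l // expr2.
  by rewrite ler_wpM2r ?wallis_le // ltW.
by rewrite -(wallis_prod R m.*2) ler_wpM2l // expr2 ler_wpM2l ?wallis_le // ltW.
Qed.

Lemma central_bin_double m : ('C(m.+1.*2, m.+1) = 2 * 'C(m.*2.+1, m))%N.
Proof.
have /eqP := mul_bin_diag m.+1.*2 m.
by rewrite doubleS /= -doubleS -mul2n -mulnA mulnCA eqn_pmul2l // => /eqP.
Qed.

Lemma half_bin_le n : ('C(n.+1, n.+1./2) <= 2 * 'C(n, n./2))%N.
Proof.
have [n_odd|n_even] := boolP (odd n).
  have -> : n = n./2.*2.+1 by lia.
  set m := n./2; rewrite (_ : m.*2.+1./2 = m); last lia.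
  by rewrite -central_bin_double -doubleS doubleK.
have -> : n = n./2.*2 by lia.
set m := n./2; rewrite doubleK (_ : m.*2.+1./2 = m); last lia.
by have := mul_bin_down m.*2.+1 m; rewrite /=; nia.
Qed.

(** An odd row reduces to the next even row, whose central coefficient is twice as large; this shift
    is the source of [n.+2]. *)
Lemma half_bin_bounds (R : realType) n :
  (n%:R * (pi * 'C(n, n./2)%:R ^+ 2) : R) <= 2 * 4 ^+ n /\
  (2 * 4 ^+ n : R) <= n.+2%:R * (pi * 'C(n, n./2)%:R ^+ 2).
Proof.
have pi0 : 0 < pi :> R := pi_gt0 R.
have [n_odd|n_even] := boolP (odd n).
  have [lb ub] := central_bin_bounds R n./2.+1.
  have := central_bin_double n./2.
  rewrite (_ : n./2.*2.+1 = n); last lia.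
  move=> cE; move: lb ub; rewrite cE.
  rewrite (_ : n./2.+1.*2 = n.+1); last lia.
  rewrite natrM [4 ^+ _]exprS => lb ub.
  have := mulr_ge0 (ltW pi0) (sqr_ge0 ('C(n, n./2)%:R : R)).
  by rewrite -[n.+2%:R]natr1 -[n.+1%:R]natr1 in lb ub *; split; lra.
have [lb ub] := central_bin_bounds R n./2.
rewrite (_ : n./2.*2 = n) in lb ub; last lia.
split=> //; apply: (le_trans ub).
by rewrite ler_wpM2r ?ler_nat // mulr_ge0 ?sqr_ge0 ?ltW.
Qed.

(** * Squeezing the ratio *)

(** For the two binomials a and b, b <= 2a gives b^2/2 <= ab <= 2a^2, so the upper bound on a^2 and
    the lower bound on b^2 suffice. *)
Lemma half_bin_ratio (R : realType) n :
  1 - 3 * @harmonic R n <=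
  ('C(n.+1, n.+1./2) * 'C(n.+2, n.+2./2))%N%:R
    / (4 / (pi : R) * (4 ^+ n.+1 / n.+1%:R)) <= 1.
Proof.
have [ub _] := half_bin_bounds R n.+1.
have [_ lb] := half_bin_bounds R n.+2.
have := half_bin_le n.+1; rewrite -(ler_nat R) !natrM.
have pi0 : 0 < pi :> R := pi_gt0 R.
have P0 : 0 < 4 ^+ n.+1 :> R by rewrite exprn_gt0.
have N0 : 0 < n.+1%:R :> R by rewrite ltr0n.
have a0 : 0 <= 'C(n.+1, n.+1./2)%:R :> R := ler0n _ _.
have b0 : 0 <= 'C(n.+2, n.+2./2)%:R :> R := ler0n _ _.
rewrite [4 ^+ n.+2]exprS (_ : n.+4%:R = n.+1%:R + 3) in lb;
  last by rewrite -natrD addn3.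
rewrite /harmonic /=.
move: pi0 P0 N0 a0 b0 ub lb; move: (pi) (4 ^+ n.+1) (n.+1%:R)
  ('C(n.+1, _)%:R) ('C(n.+2, _)%:R).
move=> p P N a b p0 P0 N0 a0 b0 ub lb ba.
have -> : a * b / (4 / p * (P / N)) = N * (p * (a * b)) / (4 * P).
  by field; rewrite !gt_eqF.
have ab_ge : p * b ^+ 2 <= 2 * (p * (a * b)).
  rewrite (_ : 2 * _ = p * (2 * a * b)); last by ring.
  by rewrite expr2 !ler_wpM2l ?(ltW p0) // ler_wpM2r.
have X0 : 0 <= p * (a * b) by rewrite !mulr_ge0 // ltW.
apply/andP; split; last first.
  rewrite ler_pdivrMr ?mulr_gt0 // mul1r.
  have : N * (p * (a * b)) <= N * (p * (a * (2 * a))).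
    by rewrite !ler_wpM2l ?(ltW p0) ?(ltW N0).
  by lra.
have PX : 4 * P <= (N + 3) * (p * (a * b)).
  have : (N + 3) * (p * b ^+ 2) <= (N + 3) * (2 * (p * (a * b))).
    by rewrite ler_wpM2l // addr_ge0 ?ltW.
  by lra.
rewrite ler_pdivlMr ?mulr_gt0 //; move: (p * (a * b)) X0 PX {ab_ge} => X X0 PX.
rewrite (_ : (1 - 3 / N) * (4 * P) = (N - 3) * (4 * P) / N); last first.
  by field; rewrite gt_eqF.
rewrite ler_pdivrMr //.
(* For N <= 3 the lower bound is not positive; otherwise multiply [PX] by N - 3 and use (N - 3)(N +
   3) <= N^2. *)
have [N3|N3] := leP N 3.
  apply: (@le_trans _ _ 0); last by rewrite !mulr_ge0 // ltW.
  by rewrite mulr_le0_ge0 ?subr_le0 // mulr_ge0 // ltW.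
apply: (@le_trans _ _ ((N - 3) * ((N + 3) * X))).
  by rewrite ler_wpM2l // subr_ge0 ltW.
by lra.
Qed.

(** * Summation over endpoints and the limit *)

Lemma sum_q_walks_from (R : realType) n :
  \sum_(p \in [set: nat * nat]) ((q p.1 p.2 n)%:R : R) =
  (walks_from n (0, 0))%:R.
Proof.
(* Absolute values turn the endpoint into a pair of naturals, losing nothing for quadrant walks; [r]
   then covers all nonzero terms. *)
pose e (w : n.-tuple step) := (`|(position w n).1|%N, `|(position w n).2|%N).
pose r := undup [seq e w | w : n.-tuple step].
have e_eq (w : n.-tuple step) i j : quarter_plane_walk w ->
    (position w n == (i%:Z, j%:Z)) = (e w == (i, j)).
  move=> /forallP/(_ ord_max); rewrite /in_quarter_plane /e /=.
  by case: (position w n) => x y /= /andP[x0 y0]; rewrite !xpair_eqE; lia.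
have qE p : q p.1 p.2 n =
    (\sum_(w : n.-tuple step | quarter_plane_walk w) (e w == p))%N.
  rewrite /q -sum1dep_card big_mkcondr; apply: eq_bigr => w wQ.
  by rewrite e_eq // -surjective_pairing; case: eqP.
rewrite (fsbigE r) ?undup_uniq //=; last first.
  move=> p _ p_r; rewrite qE big1 // => w _; apply/eqP; rewrite eqb0.
  by apply: contra p_r => /eqP <-; rewrite mem_undup fintype.image_f.
under eq_bigl do rewrite in_setT.
under eq_bigr do rewrite qE.
(* After the exchange each quadrant walk is counted once, at its own endpoint. *)
rewrite -natr_sum exchange_big /=; congr (_%:R).
rewrite /walks_from -sum1dep_card.
apply: eq_big => [w|w _]; first by rewrite quarter_plane_walkE.
rewrite (bigD1_seq (e w)) ?undup_uniq ?mem_undup ?fintype.image_f //= eqxx.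
by rewrite big1 // => p /negbTE; rewrite eq_sym => ->.
Qed.

Local Open Scope classical_set_scope.

Theorem proposition3p5 (R : realType) :
  (\sum_(p \in [set: nat * nat]) ((q p.1 p.2 n)%:R : R))
    / (4 / pi * (4 ^+ n / n%:R)) @[n --> \oo] --> (1 : R).
Proof.
pose u n : R := ('C(n, n./2) * 'C(n.+1, n.+1./2))%N%:R
  / (4 / pi * (4 ^+ n / n%:R)).
suff : u n @[n --> \oo] --> (1 : R).
  apply: cvg_trans; apply: near_eq_cvg; apply: nearW => n.
  by rewrite /u sum_q_walks_from walks_from_origin.
(* Dropping [n = 0] avoids the division by 0 there and matches the index of [harmonic]. *)
rewrite -cvg_shiftS /=.
apply: (@squeeze_cvgr _ _ _ _ (fun n => 1 - 3 * harmonic n) (fun=> 1)).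
- by apply: nearW => n; exact: half_bin_ratio.
- rewrite -[X in _ --> X](subr0 1) -[X in _ - X](mulr0 3).
  by apply: cvgB; [exact: cvg_cst | apply: cvgMr; exact: cvg_harmonic].
- exact: cvg_cst.
Qed.
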